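(* Let $n,l\ge 1$ be integers. For every deterministic simultaneous protocol for bipartite matching with $n$ players and $n$ items in which each player sends at most $l$ bits, the approximation ratio is no better than $\dfrac{n}{8l+4\log n}$; that is, if the protocol has approximation ratio $c$, then $c\ge \dfrac{n}{8l+4\log n}$. In particular, for every fixed $\epsilon>0$ and $l=n^{\epsilon}$, the approximation ratio is $\Omega(n^{1-\epsilon})$.
   Context: Bipartite matching problem: there are $n$ players and $n$ items. Player $i$ privately knows a set $S_i$ of items (his neighbor set in a bipartite graph), and nothing else about the input. In a deterministic simultaneous protocol with $l$ bits per player, each player $i$ sends to a central planner one message of at most $l$ bits (so there are at most $2^l$ possible messages) that is a function of $S_i$ only; the planner, based only on the $n$ messages, outputs a vector $(a_1,\dots,a_n)$ in which each $a_i$ is an item assigned to player $i$ (or ''nothing'') and no item is assigned to two players. The value of the output is $|\{i : a_i\in S_i\}|$. $OPT$ denotes the size of a maximum matching, i.e. the largest value of any such assignment. The protocol has approximation ratio $c\ge 1$ if on every input $(S_1,\dots,S_n)$ the value of its output is at least $OPT/c$. $\log$ is base 2; non-integer message lengths are rounded down. *)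

(* Defs.v *)
From HB Require Import structures.
From mathcomp Require Import all_boot all_order all_algebra.
From mathcomp Require Import all_classical all_reals all_analysis.

Set Implicit Arguments.
Unset Strict Implicit.
Unset Printing Implicit Defensive.

Import Order.TTheory GRing.Theory Num.Theory.
Local Open Scope ring_scope.

(* The neighbor set of every player; players and items are both indexed by
   'I_n. *)
Definition instance (n : nat) := 'I_n -> {set 'I_n}.

(* [a i = Some j]: item j goes to player i; [a i = None]: player i gets
   nothing. Assigned items need not be neighbors of their players. *)
Definition assignment (n : nat) := {ffun 'I_n -> option 'I_n}.

Definition feasible (n : nat) (a : assignment n) : bool :=
  [forall i, forall i', (a i != None) ==> (a i == a i') ==> (i == i')].

Definition value (n : nat) (S : instance n) (a : assignment n) : nat :=
  #|[set i | if a i is Some j then j \in S i else false]|.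

Definition opt (n : nat) (S : instance n) : nat :=
  (\max_(a : assignment n | feasible a) value S a)%N.

(* A message of at most l bits is one of at most 2 ^ l possible messages, which
   may be encoded by l-bit words. Simultaneity: the message of a player is a
   function of his index and neighbor set only. *)
Record protocol (n l : nat) := Protocol {
  message : 'I_n -> {set 'I_n} -> l.-tuple bool;
  planner : {ffun 'I_n -> l.-tuple bool} -> assignment n;
  planner_feasible : forall m, feasible (planner m) }.

Definition output (n l : nat) (P : protocol n l) (S : instance n) :
    assignment n :=
  planner P [ffun i => message P i (S i)].

Definition approximation_ratio (R : realType) (n l : nat) (P : protocol n l)
    (c : R) : Prop :=
  1 <= c /\
  forall S : instance n, (opt S)%:R / c <= (value S (output P S))%:R.

Definition log2 (R : realType) (x : R) : R := ln x / ln 2.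

(* Main.v *)
(* Fooling argument. Let T be the image of k random items, where 2 ^ k is at
   least 2 ^ (l + 1) * (n + 1). A union bound over the messages and over the
   item j to be avoided shows that, for some T, at least half of the players i
   are typical: for every j outside T, at least a fraction 1 / 2 ^ k of the
   k-tuples have an image that avoids j and yields the same message of i as T.
   Let a be the output when all players hold T. Since a fraction (|B| / n) ^ k
   of the tuples lie inside a given set B, as long as fewer than n / 2 items B
   have been used, a typical player can be given a set with the same message as
   T, avoiding his item in a (unless it is in T) but containing an item outside
   B. The new instance has OPT >= n / 2 and output a, whose hits all lie in T
   and therefore number at most k. *)
Require Import Defs.
From HB Require Import structures.
From mathcomp Require Import all_boot all_order all_algebra.
From mathcomp Require Import zify ring lra.
From mathcomp Require Import all_classical all_reals all_analysis.

Set Implicit Arguments.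
Unset Strict Implicit.
Unset Printing Implicit Defensive.

Import Order.TTheory GRing.Theory Num.Theory.
Local Open Scope ring_scope.

(** Induction on [s]: the tail occupies fewer than [b] items, so the hypothesis, with [B] the set of
    these items, offers the new player a set containing a fresh item. *)
Lemma greedy_matching (n b : nat) (F : 'I_n -> {set {set 'I_n}})
    (T : {set 'I_n}) (s : seq 'I_n) :
  (forall i (B : {set 'I_n}), i \in s -> (#|B| < b)%N ->
     exists2 S, S \in F i & ~~ (S \subset B)) ->
  uniq s -> (size s <= b)%N ->
  exists S : instance n, exists x : 'I_n -> 'I_n,
    [/\ forall i, i \in s -> (S i \in F i) && (x i \in S i),
        forall i, i \notin s -> S i = T
      & {in s &, injective x}].
Proof.
elim: s => [|i0 s IHs] /= spread uniq_s size_s.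
  by exists (fun=> T), id; split.
have /andP[i0s {}uniq_s] := uniq_s.
have [|//||S [x [SF ST injx]]] := IHs; last 1 first.
- have [|Si0 Si0F] := spread i0 [set x i | i in s] (mem_head _ _).
    apply: leq_ltn_trans (leq_imset_card _ _) _.
    exact: leq_ltn_trans (card_size _) size_s.
  move=> /subsetPn[y ySi0 yNx].
  have yx i : i \in s -> y <> x i.
    by move=> si eq_y; move/negP: yNx; apply; rewrite eq_y; exact: imset_f.
  exists (fun i => if i == i0 then Si0 else S i).
  exists (fun i => if i == i0 then y else x i); split.
  + move=> i; rewrite inE; case: eqVneq => [->|_ /=]; last exact: SF.
    by rewrite Si0F ySi0.
  + by move=> i; rewrite inE; case: eqVneq => // _ /=; exact: ST.
  + move=> i i'; rewrite !inE.
    case: (eqVneq i i0) => [->|_]; case: (eqVneq i' i0) => [->|_] //=.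
    * by move=> _ /yx.
    * by move=> /yx yxi _ /esym.
    * exact: injx.
- by move=> i B si; apply: spread; rewrite inE si orbT.
- exact: ltnW.
Qed.

(** * Counting tuples and the union bound *)

Section Counting.
Context (n k : nat).

(* Random sets are sampled as images of tuples: this replaces the binomial
   estimates for k-subsets by powers. *)
Definition img (f : {ffun 'I_k -> 'I_n}) : {set 'I_n} := [set f u | u : 'I_k].

Lemma card_img f : (#|img f| <= k)%N.
Proof. by rewrite (leq_trans (leq_imset_card _ _)) ?card_ord. Qed.

Lemma card_img_subset (B : {set 'I_n}) :
  #|[set f | img f \subset B]| = (#|B| ^ k)%N.
Proof.
rewrite -[X in (_ ^ X)%N](card_ord k) -card_ffun_on; apply: eq_card => f.
rewrite inE; apply/fintype.subsetP/ffun_onP => [fB u|fB _ /imsetP[u _ ->]].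
  by apply: fB; apply: imset_f.
exact: fB.
Qed.

(* The value [None] covers the players whose assigned item may be ignored. *)
Definition avoids (S : {set 'I_n}) (o : option 'I_n) : bool :=
  if o is Some j then j \notin S else true.

(** Only [#|B| ^ k] tuples have image inside [B], and [2 * #|B| < n] makes [2 ^ k * #|B| ^ k]
    smaller than [n ^ k]. *)
Lemma large_family_not_subset (A : {set {ffun 'I_k -> 'I_n}})
    (B : {set 'I_n}) :
  (0 < k)%N -> (n ^ k <= 2 ^ k * #|A|)%N -> (#|B| < uphalf n)%N ->
  exists2 f, f \in A & ~~ (img f \subset B).
Proof.
move=> k_gt0 largeA smallB.
have : ~~ (A \subset [set f | img f \subset B]).
  apply: contraL largeA => /subset_leq_card; rewrite card_img_subset => leA.
  rewrite -ltnNge (leq_ltn_trans (leq_mul (leqnn _) leA)) // -expnMn.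
  by rewrite ltn_exp2r // mul2n -gtn_uphalf_double.
by move=> /subsetPn[f fA]; rewrite inE => ?; exists f.
Qed.

Definition fiber (M : finType) (msg : {set 'I_n} -> M) (m : M)
    (o : option 'I_n) : {set {ffun 'I_k -> 'I_n}} :=
  [set g | (msg (img g) == m) && avoids (img g) o].

Definition typical (M : finType) (msg : {set 'I_n} -> M)
    (f : {ffun 'I_k -> 'I_n}) : bool :=
  [forall o, avoids (img f) o ==>
    (n ^ k <= 2 ^ k * #|fiber msg (msg (img f)) o|)%N].

(** Union bound: an atypical tuple lies in a fiber of at most [n ^ k / 2 ^ k] tuples, and fibers are
    indexed by [#|M| * n.+1] pairs, the successor accounting for [None]. *)
Lemma card_atypical (M : finType) (msg : {set 'I_n} -> M) :
  (2 * (#|M| * n.+1) <= 2 ^ k)%N ->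
  (2 * #|[set f | ~~ typical msg f]| <= n ^ k)%N.
Proof.
move=> large_k; set A := [set f | _].
pose small (p : M * option 'I_n) := (2 ^ k * #|fiber msg p.1 p.2| <= n ^ k)%N.
have covA : A \subset \bigcup_(p | small p) fiber msg p.1 p.2.
  apply/fintype.subsetP => f; rewrite inE negb_forall => /existsP[oi].
  rewrite negb_imply -ltnNge => /andP[foi /ltnW small_foi].
  by apply/bigcupP; exists (msg (img f), oi) => //; rewrite inE eqxx.
have leA : (2 ^ k * #|A| <= #|M| * n.+1 * n ^ k)%N.
  have -> : (#|M| * n.+1 = #|{: M * option 'I_n}|)%N.
    by rewrite card_prod card_option card_ord.
  apply: (@leq_trans (2 ^ k * \sum_(p | small p) #|fiber msg p.1 p.2|)%N).
    rewrite leq_mul2l; apply/orP; right.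
    apply: leq_trans (subset_leq_card covA) _.
    apply: (big_ind2 (fun (B : {set _}) m => #|B| <= m)%N).
    - by rewrite cards0.
    - move=> B x C y Bx Cy.
      exact: leq_trans (leq_card_setU _ _) (leq_add Bx Cy).
    - by [].
  rewrite big_distrr /= -sum_nat_const big_mkcond leq_sum // => p _.
  by case: ifP.
have M_gt0 : (0 < #|M| * n.+1)%N.
  by rewrite muln_gt0 andbT; apply/card_gt0P; exists (msg finset.set0).
rewrite -(leq_pmul2l M_gt0) (leq_trans _ leA) // mulnA leq_mul2r.
by rewrite (mulnC _ 2) large_k orbT.
Qed.

(** Double counting of pairs of a tuple and a player atypical for it. If every tuple failed, each
    would have more than [n / 2] atypical players, while [card_atypical] allows at most
    [n * n ^ k / 2] pairs. *)
Lemma typical_for_half (M : finType) (msg : 'I_n -> {set 'I_n} -> M) :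
  (0 < n)%N -> (2 * (#|M| * n.+1) <= 2 ^ k)%N ->
  exists f, (n <= 2 * #|[set i | typical (msg i) f]|)%N.
Proof.
move=> n_gt0 large_k; pose good f := [set i | typical (msg i) f].
have [/existsP//|/existsPn few] :=
  boolP [exists f, n <= 2 * #|good f|]%N.
have : (\sum_(f : {ffun 'I_k -> 'I_n}) 2 * #|~: good f| <= n * n ^ k)%N.
  rewrite -big_distrr /=.
  have cardE f : #|~: good f| = (\sum_i (i \in ~: good f))%N.
    by rewrite -sum1_card big_mkcond; apply: eq_bigr => i _; case: ifP.
  rewrite (eq_bigr _ (fun f _ => cardE f)).
  rewrite exchange_big /= big_distrr /= -[X in (_ <= X * _)%N]card_ord.
  rewrite -sum_nat_const leq_sum // => i _.
  apply: leq_trans (card_atypical (msg i) large_k); rewrite leq_mul2l /=.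
  rewrite -sum1_card [X in (_ <= X)%N]big_mkcond leq_sum // => f _.
  by rewrite !inE; case: typical.
have : (n.+1 * n ^ k <= \sum_(f : {ffun 'I_k -> 'I_n}) 2 * #|~: good f|)%N.
  rewrite mulnC -[X in (_ ^ X * _)%N](card_ord k).
  rewrite -[X in (X ^ _ * _)%N](card_ord n).
  rewrite -card_ffun -sum_nat_const leq_sum // => f _.
  have := few f; rewrite -ltnNge.
  have := cardsC (good f); rewrite card_ord; lia.
move=> /leq_trans/[apply]; rewrite leq_pmul2r ?expn_gt0 ?n_gt0 //.
by rewrite ltnn.
Qed.

End Counting.

(** * Bounds on values and the fooling instance *)

Lemma value_le_opt n (S : instance n) (a : assignment n) :
  feasible a -> (value S a <= opt S)%N.
Proof. exact: leq_bigmax_cond. Qed.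

Lemma injective_le_opt n (S : instance n) (s : seq 'I_n) (x : 'I_n -> 'I_n) :
  uniq s -> (forall i, i \in s -> x i \in S i) -> {in s &, injective x} ->
  (size s <= opt S)%N.
Proof.
move=> uniq_s xS injx.
pose a : assignment n := [ffun i => if i \in s then Some (x i) else None].
have fa : feasible a.
  apply/forallP => i; apply/forallP => i'; rewrite !ffunE.
  case: ifP => // si; case: ifP => // si'; apply/implyP => _.
  by apply/implyP => /eqP[/injx->].
apply: leq_trans (value_le_opt S fa); rewrite -(card_uniqP uniq_s).
apply/subset_leq_card/fintype.subsetP => i si.
by rewrite inE ffunE si xS.
Qed.

Lemma value_le_card n (S : instance n) (a : assignment n) (T : {set 'I_n}) :
  feasible a ->
  (forall i j, a i = Some j -> j \in S i -> j \in T) -> (value S a <= #|T|)%N.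
Proof.
move=> fa hitT; rewrite /value.
set H := [set i | _].
suff : (#|H| <= #|[set Some j | j in T]|)%N by rewrite card_imset // => ? ? [].
have injH : {in H &, injective a}.
  move=> i i'; rewrite inE; case ai: (a i) => [j|//] _ _ eq_a.
  have /forallP/(_ i)/forallP/(_ i') := fa.
  by rewrite ai -eq_a eqxx /= => /eqP.
rewrite -(card_in_imset injH).
apply/subset_leq_card/fintype.subsetP => _ /imsetP[i iH ->]; move: iH.
rewrite inE.
case ai: (a i) => [j|//] jS; apply/imsetP; exists j => //.
exact: hitT ai jS.
Qed.

Lemma hard_instance n l k (P : protocol n l) :
  (0 < n)%N -> (0 < k)%N -> (2 * (2 ^ l * n.+1) <= 2 ^ k)%N ->
  exists S : instance n, (uphalf n <= opt S)%N /\ (value S (output P S) <= k)%N.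
Proof.
move=> n_gt0 k_gt0 large_k.
have [|f many] := @typical_for_half n k _ (message P) n_gt0 _.
  by rewrite card_tuple card_bool.
set T := img f; set G := [set i | _] in many.
pose a := output P (fun=> T).
pose F i : {set {set 'I_n}} := [set S | (message P i S == message P i T) &&
  (if a i is Some j then (j \in T) || (j \notin S) else true)].
(* Stopping at [uphalf n] players keeps the number of used items below the threshold of
   [large_family_not_subset]. *)
pose s := take (uphalf n) (enum G).
have sG i : i \in s -> i \in G by move=> /mem_take; rewrite mem_enum.
have size_s : size s = uphalf n.
  by rewrite size_takel // -cardE leq_uphalf_double -mul2n.
have uniq_s : uniq s by rewrite take_uniq ?enum_uniq.
have spread i (B : {set 'I_n}) : i \in s -> (#|B| < uphalf n)%N ->
    exists2 S, S \in F i & ~~ (S \subset B).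
  move=> /sG; rewrite inE => /forallP typ smallB.
  (* Typicality only speaks of items outside [T]; an assigned item in [T] is harmless, being counted
     among the at most [k] hits, so it becomes [None]. *)
  pose o := if a i is Some j then (if j \in T then None else Some j) else None.
  have To : avoids T o by rewrite /o; case: (a i) => // j; case: ifP => //= ->.
  have := typ o; rewrite To /= => large.
  have [g gF gB] := large_family_not_subset k_gt0 large smallB.
  exists (img g) => //; move: gF; rewrite !inE => /andP[-> ].
  by rewrite /o; case: (a i) => //= j; case: ifP.
have [|S [x [SF ST injx]]] := greedy_matching T spread uniq_s.
  by rewrite size_s.
have S_in i : S i \in F i.
  have [/SF/andP[]//|/ST->] := boolP (i \in s).
  by rewrite inE eqxx /=; case: (a i) => // j; case: (j \in T).
have outS : output P S = a.
  congr planner; apply/ffunP => i; rewrite !ffunE.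
  by have := S_in i; rewrite inE => /andP[/eqP].
exists S; split.
  by rewrite -size_s; apply: injective_le_opt injx => // i /SF/andP[].
rewrite outS; apply: leq_trans (card_img f); apply: value_le_card.
  exact: planner_feasible.
move=> i j ai jS; have := S_in i; rewrite inE ai jS orbF.
by case/andP.
Qed.

(** * Real-valued and asymptotic bounds *)

Lemma trunc_log_le_log2 (R : realType) (n : nat) :
  (0 < n)%N -> (trunc_log 2 n)%:R <= log2 n%:R :> R.
Proof.
move=> n_gt0; have ln2_gt0 : 0 < ln 2 :> R by rewrite ln_gt0 // ltr1n.
rewrite /log2 ler_pdivlMr // mulr_natl -lnXn // -natrX ler_ln ?posrE ?ltr0n //.
  by rewrite ler_nat trunc_logP.
by rewrite expn_gt0.
Qed.

Lemma approximation_ratio_lower_bound (R : realType) n l (P : protocol n l)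
    (c : R) : (1 <= n)%N -> (1 <= l)%N -> approximation_ratio P c ->
  n%:R / (8 * l%:R + 4 * log2 n%:R) <= c.
Proof.
move=> n_gt0 l_gt0 [c_ge1 approx].
(* Since [n.+1 <= 2 ^ (trunc_log 2 n).+1], this [k] meets the requirement of [hard_instance]; the
   extra unit pays for its factor 2. *)
pose k := (l + (trunc_log 2 n).+2)%N.
have c_gt0 : 0 < c by exact: lt_le_trans c_ge1.
have [||S [optS valS]] := @hard_instance n l k P n_gt0.
- by rewrite /k addnS.
- rewrite /k expnD mulnCA leq_mul2l [in X in _ || X]expnS leq_mul2l /=.
  by rewrite trunc_log_ltn ?orbT.
have log_ge := trunc_log_le_log2 R n_gt0.
have lR : 1 <= l%:R :> R by rewrite ler1n.
have log_ge0 : 0 <= (trunc_log 2 n)%:R :> R by [].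
rewrite ler_pdivrMr; last by lra.
have : n%:R <= 2 * (opt S)%:R :> R.
  by rewrite -natrM ler_nat mul2n -leq_uphalf_double.
have := approx S; rewrite ler_pdivrMr // => /le_trans optc le_n.
apply: le_trans le_n _.
have valR : (value S (output P S))%:R <= k%:R :> R by rewrite ler_nat.
(* The additive 4 in [2 * k] is absorbed into [8 * l] because [1 <= l]. *)
have kR : 2 * k%:R <= 8 * l%:R + 4 * log2 n%:R :> R.
  by rewrite /k natrD -addn2 natrD; lra.
have : (opt S)%:R <= k%:R * c by apply: optc; rewrite ler_wpM2r // ltW.
move=> optk; apply: le_trans (_ : 2 * (k%:R * c) <= _); first by lra.
by rewrite mulrA [leRHS]mulrC ler_wpM2r // ltW.
Qed.

Theorem theorem3p1 (R : realType) :
  (forall n l : nat, (1 <= n)%N -> (1 <= l)%N ->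
    forall (P : protocol n l) (c : R), approximation_ratio P c ->
      n%:R / (8 * l%:R + 4 * log2 n%:R) <= c)
  /\
  (forall e : R, 0 < e ->
    exists2 C : R, 0 < C &
    exists N : nat, forall n : nat, (N <= n)%N ->
      forall (P : protocol n (Num.truncn (n%:R `^ e))) (c : R),
        approximation_ratio P c -> C * n%:R `^ (1 - e) <= c).
Proof.
split=> [n l n_gt0 l_gt0 P c|e e_gt0].
  exact: approximation_ratio_lower_bound.
have ln2_gt0 : 0 < ln 2 :> R by rewrite ln_gt0 // ltr1n.
pose D : R := 8 + 4 / (e * ln 2).
have D_gt0 : 0 < D by rewrite addr_gt0 // divr_gt0 // mulr_gt0.
exists D^-1; first by rewrite invr_gt0.
exists 1%N => n n_gt0 P c approx.
have nR_gt0 : 0 < n%:R :> R by rewrite ltr0n.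
have p_ge1 : 1 <= n%:R `^ e.
  by rewrite -[X in X <= _](powRr0 n%:R) ler_powR ?ler1n // ltW.
have l_gt0 : (0 < Num.truncn (n%:R `^ e))%N by rewrite truncn_gt0.
apply: le_trans (approximation_ratio_lower_bound n_gt0 l_gt0 approx).
set l := Num.truncn _ in l_gt0 *.
have l_le : l%:R <= n%:R `^ e by rewrite truncn_le powR_ge0.
have log_le : log2 n%:R <= (n%:R `^ e) / (e * ln 2).
  rewrite /log2 invfM mulrA ler_wpM2r ?invr_ge0 ?(ltW ln2_gt0) //.
  rewrite ler_pdivlMr // mulrC -ln_powR.
  have := @le_ln1Dx R (n%:R `^ e - 1); rewrite [1 + _]addrC subrK => le_ln.
  by apply: le_trans (le_ln _) _; lra.
have log_ge0 : 0 <= log2 n%:R :> R.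
  by rewrite divr_ge0 ?ln_ge0 ?ler1n // ltW.
have lR : 1 <= l%:R :> R by rewrite ler1n.
rewrite powRB; last by rewrite lt0r_neq0 // implybT.
rewrite powRr1 // mulrC -mulrA -invfM ler_wpM2l //.
have den_gt0 : 0 < 8 * l%:R + 4 * log2 n%:R :> R by lra.
rewrite lef_pV2 ?posrE ?mulr_gt0 ?(lt_le_trans ltr01 p_ge1) //.
have -> : n%:R `^ e * D = 8 * n%:R `^ e + 4 * (n%:R `^ e / (e * ln 2)).
  by rewrite /D; ring.
lra.
Qed.
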